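(* Let $w\in\{b_1,b_2,b_{1,1}\}$, let $d\in\{2,3,4\}$ be the length of $w$, let $\lambda>0$ and $f\in[-\pi,\pi)^d$. Consider the functional $$\mathcal E(x;f,w):=\frac12\sum_{j=1}^d d(f_j,x_j)^2+\lambda\, d(x;w),\qquad x\in[-\pi,\pi)^d,$$ and set $s:=\operatorname{sgn}\big((\langle f,w\rangle)_{2\pi}\big)$. (i) If $|(\langle f,w\rangle)_{2\pi}|<\pi$, then the unique minimizer of $\mathcal E(\cdot;f,w)$ over $[-\pi,\pi)^d$ is $$\hat x=(f-s\,m\,w)_{2\pi},\qquad m:=\min\Big\{\lambda,\frac{|(\langle f,w\rangle)_{2\pi}|}{\|w\|_2^2}\Big\}.$$ (ii) If $|(\langle f,w\rangle)_{2\pi}|=\pi$, then $\mathcal E(\cdot;f,w)$ has the two minimizers $$\hat x=(f\mp s\,m\,w)_{2\pi},\qquad m:=\min\Big\{\lambda,\frac{\pi}{\|w\|_2^2}\Big\}.$$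
   Context: For $t\in\mathbb R$, $(t)_{2\pi}$ is the unique point of $[-\pi,\pi)$ with $t-(t)_{2\pi}\in2\pi\mathbb Z$; for vectors, $(\cdot)_{2\pi}$ is applied componentwise. $\operatorname{sgn}(t)$ is $1,0,-1$ for $t>0$, $t=0$, $t<0$. Points of the circle $\mathbb S^1$ are represented by angles in $[-\pi,\pi)$ with respect to a fixed base point; for $x,y\in[-\pi,\pi)$ the geodesic distance is $d(x,y)=\min_{k\in\mathbb Z}|y-x+2\pi k|=|(y-x)_{2\pi}|$. $b_1=(-1,1)^{\mathrm T}$, $b_2=(1,-2,1)^{\mathrm T}$, $b_{1,1}=(-1,1,1,-1)^{\mathrm T}$. For $w\in\mathbb R^d\setminus\{0\}$ with $\sum_j w_j=0$ put $\Delta(x;w):=\langle x,w\rangle$. The absolute cyclic difference of $x\in[-\pi,\pi)^d$ with respect to $w$ is $$d(x;w):=\min_{\alpha\in\mathbb R}\big|\Delta([x+\alpha 1_d]_{2\pi};w)\big|,$$ where $1_d$ is the all-ones vector and $[\cdot]_{2\pi}$ is applied componentwise, with $[t]_{2\pi}=(t)_{2\pi}$ if $t\notin\{(2k+1)\pi:k\in\mathbb Z\}$ and $[(2k+1)\pi]_{2\pi}=\pm\pi$, i.e. both values are allowed, independently in each component, and the minimum is also taken over these choices. *)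

(* Defs.v *)
From HB Require Import structures.
From mathcomp Require Import all_boot all_order all_algebra.
From mathcomp Require Import all_classical all_reals all_analysis.
From mathcomp Require Import ring lra zify.

Set Implicit Arguments.
Unset Strict Implicit.
Unset Printing Implicit Defensive.

Import Order.TTheory GRing.Theory Num.Theory.
Local Open Scope classical_set_scope.
Local Open Scope ring_scope.

Section Minima.
Context {R : realType}.

Definition is_minimum (S : set R) (v : R) : Prop := S v /\ lbound S v.

Definition minimizers (T : Type) (E : T -> R) (D : set T) : set T :=
  [set x | D x /\ forall y, D y -> E x <= E y].

Lemma is_minimum_inf (S : set R) (v : R) : is_minimum S v -> inf S = v.
Proof.
case=> Sv lbv; apply/eqP; rewrite eq_le; apply/andP; split.
  by apply: ge_inf => //; exists v.
by apply: lb_le_inf => //; exists v.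
Qed.

End Minima.

Section Circle.
Context {R : realType}.
Implicit Types (t u x y : R).

(* [mod2piP] and [mod2pi_uniq] below show that the selected point exists and is
   unique. *)
Definition mod2pi t : R :=
  get [set u | - pi <= u < pi /\ exists k : int, t - u = 2 * pi * k%:~R].

Definition odd_pi t : Prop := exists k : int, t = (2 * k%:~R + 1) * pi.

Definition mod2pi_set t : set R :=
  [set u | (~ odd_pi t /\ u = mod2pi t) \/ (odd_pi t /\ (u = pi \/ u = - pi))].

(* The infimum is attained, see [circle_distP]. *)
Definition circle_dist x y : R :=
  inf (range (fun k : int => `|y - x + 2 * pi * k%:~R|)).

Lemma mod2piP t : - pi <= mod2pi t < pi /\ exists k : int, t - mod2pi t = 2 * pi * k%:~R.
Proof.
have pi0 : 0 < pi :> R := pi_gt0 R.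
rewrite /mod2pi.
apply: (@getPex _ [set u | - pi <= u < pi /\ exists k : int, t - u = 2 * pi * k%:~R]).
set k := Num.floor ((t + pi) / (2 * pi)).
exists (t - 2 * pi * k%:~R); split; last by exists k; ring.
have /andP[] := floor_itv ((t + pi) / (2 * pi)).
rewrite -/k ler_pdivlMr ?mulr_gt0// ltr_pdivrMr ?mulr_gt0// intrD => h1 h2.
apply/andP; split; lra.
Qed.

Lemma int_lt1_eq0 (n : int) (a : R) : 0 < a -> - a < a * n%:~R < a -> n = 0.
Proof.
move=> a0 /andP[h1 h2].
have : -1 < n%:~R :> R by rewrite -(ltr_pM2l a0) mulrN1.
have : n%:~R < 1 :> R by rewrite -(ltr_pM2l a0) mulr1.
rewrite -[1]/(1%:~R) -intrN !ltr_int; lia.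
Qed.

Lemma mod2pi_uniq t u :
  - pi <= u < pi -> (exists k : int, t - u = 2 * pi * k%:~R) -> mod2pi t = u.
Proof.
have pi0 : 0 < pi :> R := pi_gt0 R.
move=> /andP[u1 u2] [k uk]; have [/andP[w1 w2] [l wl]] := mod2piP t.
have e : u - mod2pi t = 2 * pi * (l - k)%:~R by rewrite intrB; lra.
have n0 : l - k = 0.
  apply: (@int_lt1_eq0 _ (2 * pi)); first lra.
  by rewrite -e; apply/andP; split; lra.
move: e; rewrite n0 mulr0; lra.
Qed.

Lemma norm_mod2pi_le t (k : int) : `|mod2pi t| <= `|t + 2 * pi * k%:~R|.
Proof.
have pi0 : 0 < pi :> R := pi_gt0 R.
have [/andP[w1 w2] [l wl]] := mod2piP t.
have -> : t + 2 * pi * k%:~R = mod2pi t + 2 * pi * (l + k)%:~R.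
  by rewrite intrD; lra.
have [n0|n1|n1] : [\/ l + k = 0, 1 <= l + k | l + k <= -1] by
  case: (ltgtP (l + k) 0) => h; [apply: Or33|apply: Or32|apply: Or31]; lia.
- by rewrite n0 mulr0 addr0.
- have := n1; rewrite -(ler_int R) => n1'.
  have : 2 * pi * 1 <= 2 * pi * (l + k)%:~R :> R by rewrite ler_pM2l//; lra.
  move=> h; rewrite [X in _ <= X]ger0_norm; last lra.
  rewrite ler_norml; apply/andP; split; lra.
- have := n1; rewrite -(ler_int R) => n1'.
  have : 2 * pi * (l + k)%:~R <= 2 * pi * (-1) :> R by rewrite ler_pM2l//; lra.
  move=> h; rewrite [X in _ <= X]ler0_norm; last lra.
  rewrite ler_norml; apply/andP; split; lra.
Qed.

Lemma circle_dist_min_mod2pi x y :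
  is_minimum (range (fun k : int => `|y - x + 2 * pi * k%:~R|)) `|mod2pi (y - x)|.
Proof.
split; last by move=> _ [k _ <-]; exact: norm_mod2pi_le.
have [_ [l wl]] := mod2piP (y - x).
by exists (- l) => //=; congr (`|_|); rewrite intrN; lra.
Qed.

Lemma circle_distE x y : circle_dist x y = `|mod2pi (y - x)|.
Proof. exact/is_minimum_inf/circle_dist_min_mod2pi. Qed.

Lemma circle_distP x y :
  is_minimum (range (fun k : int => `|y - x + 2 * pi * k%:~R|)) (circle_dist x y).
Proof. by rewrite circle_distE; exact: circle_dist_min_mod2pi. Qed.

Lemma mod2pi_setP t u : mod2pi_set t u ->
  - pi <= u <= pi /\ exists k : int, t - u = 2 * pi * k%:~R.
Proof.
have pi0 : 0 < pi :> R := pi_gt0 R.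
case=> [[_ ->]|[[k tk] [->|->]]].
- by have [/andP[-> /ltW ->]] := mod2piP t.
- split; first by apply/andP; split; lra.
  by exists k; rewrite tk; ring.
- split; first by apply/andP; split; lra.
  by exists (k + 1); rewrite tk intrD; ring.
Qed.

End Circle.

Section CyclicDifferences.
Context {R : realType}.

Definition torus {d : nat} : set 'cV[R]_d :=
  [set x | forall i, - pi <= x i 0 < pi].

Definition mod2piv {d : nat} (x : 'cV[R]_d) : 'cV[R]_d := map_mx mod2pi x.

Definition inner {d : nat} (x w : 'cV[R]_d) : R := \sum_(i < d) x i 0 * w i 0.

Definition sqnorm2 {d : nat} (w : 'cV[R]_d) : R := \sum_(i < d) w i 0 ^+ 2.

Definition b1 : 'cV[R]_2 := \col_(i < 2) [:: -1; 1]`_i.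
Definition b2 : 'cV[R]_3 := \col_(i < 3) [:: 1; -2; 1]`_i.
Definition b11 : 'cV[R]_4 := \col_(i < 4) [:: -1; 1; 1; -1]`_i.

Inductive diff_weight : forall d : nat, 'cV[R]_d -> Prop :=
| diff_weight_b1 : diff_weight b1
| diff_weight_b2 : diff_weight b2
| diff_weight_b11 : diff_weight b11.

Definition abs_diffs {d : nat} (x w : 'cV[R]_d) : set R :=
  [set v | exists (a : R) (y : 'cV[R]_d),
     (forall i, mod2pi_set (x i 0 + a) (y i 0)) /\ v = `|inner y w|].

(* The infimum is attained for the weights of interest, see [cyc_diffP]. *)
Definition cyc_diff {d : nat} (x w : 'cV[R]_d) : R := inf (abs_diffs x w).

Definition energy {d : nat} (lambda : R) (f w x : 'cV[R]_d) : R :=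
  2^-1 * \sum_(j < d) circle_dist (f j 0) (x j 0) ^+ 2 + lambda * cyc_diff x w.

Lemma abs_diffs_neq0 d (x w : 'cV[R]_d) : abs_diffs x w !=set0.
Proof.
pose y : 'cV[R]_d := \col_i (if `[< odd_pi (x i 0) >] then pi else mod2pi (x i 0)).
exists `|inner y w|, 0, y; split=> // i; rewrite addr0 mxE /mod2pi_set/=.
by case: asboolP => h; [right; split=> //; left|left].
Qed.

Lemma abs_diffs_finite d (x w : 'cV[R]_d) : \sum_i w i 0 = 0 -> torus x ->
  forall v, abs_diffs x w v -> exists k : {ffun 'I_d -> 'I_3},
    v = `|inner x w - 2 * pi * \sum_i ((k i)%:R - 1) * w i 0|.
Proof.
have pi0 : 0 < pi :> R := pi_gt0 R.
move=> w0 tx v [a [y [ya ->]]].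
have [/andP[wa1 wa2] [n an]] := mod2piP a.
have /all_sig[k kP] (i : 'I_d) : {k : 'I_3 |
    y i 0 = x i 0 + mod2pi a - 2 * pi * (k%:R - 1)}.
  apply: cid; have [/andP[y1 y2] [l yl]] := mod2pi_setP (ya i).
  have /andP[x1 x2] := tx i.
  have e : 2 * pi * (l - n)%:~R = x i 0 + mod2pi a - y i 0 by rewrite intrB; lra.
  have h2 : (l - n)%:~R < 2 :> R.
    have h : 0 < 2 * pi :> R by lra.
    rewrite -(ltr_pM2l h) e; lra.
  have h1 : - 2 < (l - n)%:~R :> R.
    have h : 0 < 2 * pi :> R by lra.
    rewrite -(ltr_pM2l h) e; lra.
  have k0 : 0 <= l - n + 1.
    by move: h1; rewrite -[2]/(2%:~R) -intrN ltr_int; lia.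
  have k3 : (`|(l - n + 1)%R|%N < 3)%N.
    by move: h2; rewrite -[2]/(2%:~R) ltr_int; lia.
  exists (Ordinal k3) => /=.
  have -> : (`|(l - n + 1)%R|%N)%:R = (l - n + 1)%:~R :> R.
    by rewrite -[in RHS](gez0_abs k0).
  by rewrite intrD addrK e; ring.
exists (finfun k); congr (`|_|).
rewrite /inner mulr_sumr -sumrB.
transitivity (\sum_i (x i 0 * w i 0 - 2 * pi * (((finfun k) i)%:R - 1) * w i 0
    + mod2pi a * w i 0)).
  by apply: eq_bigr => i _; rewrite kP ffunE; ring.
rewrite big_split/= -mulr_sumr w0 mulr0 addr0.
by apply: eq_bigr => i _; ring.
Qed.

Lemma cyc_diffP d (x w : 'cV[R]_d) : \sum_i w i 0 = 0 -> torus x ->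
  is_minimum (abs_diffs x w) (cyc_diff x w).
Proof.
move=> w0 tx; have fin := abs_diffs_finite w0 tx.
pose g (k : {ffun 'I_d -> 'I_3}) : R :=
  `|inner x w - 2 * pi * \sum_i ((k i)%:R - 1) * w i 0|.
have [v Sv] := abs_diffs_neq0 x w.
have [k0 vk0] := fin _ Sv.
have Pk0 : `[< abs_diffs x w (g k0) >] by apply/asboolP; rewrite /g -vk0.
suff [k kmin] : exists k, is_minimum (abs_diffs x w) (g k).
  by rewrite /cyc_diff (is_minimum_inf kmin).
case: (@arg_minP _ _ _ k0 (fun k => `[< abs_diffs x w (g k) >]) g Pk0) => k.
move=> /asboolP Pk kmin; exists k; split=> // u Su.
have [l ul] := fin _ Su; rewrite ul; apply: kmin.
by apply/asboolP; rewrite /g -ul.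
Qed.

Lemma diff_weight_sum0 d (w : 'cV[R]_d) : diff_weight w -> \sum_i w i 0 = 0.
Proof.
by case; rewrite !big_ord_recl big_ord0 !mxE /=; ring.
Qed.

End CyclicDifferences.

Arguments b1 : clear implicits.
Arguments b2 : clear implicits.
Arguments b11 : clear implicits.

(* Main.v *)
Require Import Defs.
From mathcomp Require Import all_boot all_order all_algebra.
From mathcomp Require Import all_classical all_reals all_analysis.
From mathcomp Require Import ring lra zify.

Import Order.TTheory GRing.Theory Num.Theory.
Local Open Scope classical_set_scope.
Local Open Scope ring_scope.

(** The theorem reduces a nonconvex problem on the torus to a convex one on a
    Euclidean space, in two steps.

    First, for the three weights the absolute cyclic difference is
    d(x;w) = |(<x,w>)_{2pi}| ([cyc_diffE]). Since w is integral and sums to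
    zero, every value <y,w> admitted in the definition is congruent to <x,w>
    modulo 2pi, which gives the lower bound. For attainment one must cut the
    circle so that the unwrapped points y satisfy |<y,w>| <= pi. Moving the cut
    past a point changes <y,w> by a multiple of 2pi, and an inspection of the
    positions of the points shows that a good cut always exists
    ([diff_weight_unwrap]).

    Second, let t = (<f,w>)_{2pi}, n = |w|^2, v the vector of the signed
    distances (x_j - f_j)_{2pi}, and r = (<x,w>)_{2pi}. Then r = c + <v,w> for
    some c congruent to <f,w>, and completing the square around v = - sgn(c) m w
    yields, whenever 0 <= m <= lambda,

      |v|^2 / 2 + lambda |r|
         >= m |c| - m^2 n / 2 + |v + sgn(c) m w|^2 / 2     ([energy_ge]).

    All such c satisfy |c| >= |t|. For m = min(lambda, |t| / n) the point
    x = (f - sgn(c) m w)_{2pi} with |c| = |t| has energy at most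
    m |t| - m^2 n / 2 ([energy_le]), so this is the minimal value, and equality
    forces v = - sgn(c) m w and, unless m = 0, |c| = |t|. Hence the minimizers
    correspond to the representatives c of <f,w> with |c| = |t|
    ([minimizersE]): only c = t if |t| < pi, but both t and -t if |t| = pi. *)

(** * Congruence modulo 2pi *)

Section Congruence.
Context {R : realType}.
Implicit Types (s t u c : R).

Definition congr2pi s t : Prop := exists k : int, s - t = 2 * pi * k%:~R.

Lemma congr2pi_refl t : congr2pi t t.
Proof. by exists 0; rewrite subrr mulr0. Qed.

Lemma congr2pi_sym {s t} : congr2pi s t -> congr2pi t s.
Proof. by case=> k e; exists (- k); rewrite intrN; lra. Qed.

Lemma congr2pi_trans {s t u} : congr2pi s t -> congr2pi t u -> congr2pi s u.
Proof. by case=> k e [l e']; exists (k + l); rewrite intrD; lra. Qed.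

Lemma congr2piD {s t s' t'} :
  congr2pi s t -> congr2pi s' t' -> congr2pi (s + s') (t + t').
Proof. by case=> k e [l e']; exists (k + l); rewrite intrD; lra. Qed.

Lemma congr2piB {s t s' t'} :
  congr2pi s t -> congr2pi s' t' -> congr2pi (s - s') (t - t').
Proof. by case=> k e [l e']; exists (k - l); rewrite intrB; lra. Qed.

Lemma congr2piMint {s t} c :
  c \is a Num.int -> congr2pi s t -> congr2pi (s * c) (t * c).
Proof.
by move=> /intrP[l ->] [k e]; exists (k * l); rewrite -mulrBl e intrM mulrA.
Qed.

Lemma congr2pi_addl {s t} : congr2pi s t -> congr2pi (s + 2 * pi) t.
Proof. by case=> k e; exists (k + 1); rewrite intrD; lra. Qed.

Lemma congr2pi_subl {s t} : congr2pi s t -> congr2pi (s - 2 * pi) t.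
Proof. by case=> k e; exists (k - 1); rewrite intrB; lra. Qed.

Lemma congr2pi_sum d (F G : 'I_d -> R) : (forall i, congr2pi (F i) (G i)) ->
  congr2pi (\sum_i F i) (\sum_i G i).
Proof.
by move=> FG; apply: big_ind2 => // [|s t s' t' st st'];
  [exact: congr2pi_refl | exact: congr2piD].
Qed.

Lemma congr2pi_mod2pi t : congr2pi (mod2pi t) t.
Proof. exact/congr2pi_sym/(mod2piP t).2. Qed.

Lemma mod2pi_congr {s t} : congr2pi s t -> mod2pi s = mod2pi t.
Proof.
move=> st; apply: mod2pi_uniq; first exact: (mod2piP t).1.
exact/(congr2pi_trans st)/congr2pi_sym/congr2pi_mod2pi.
Qed.

Lemma mod2pi_id {t} : - pi <= t < pi -> mod2pi t = t.
Proof. by move=> tpi; apply: mod2pi_uniq => //; exact: congr2pi_refl. Qed.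

Lemma norm_mod2pi_le_congr {s t} : congr2pi s t -> `|mod2pi s| <= `|t|.
Proof.
move=> /mod2pi_congr ->; have := norm_mod2pi_le t 0.
by rewrite mulr0 addr0.
Qed.

Lemma mod2pi_norm_le_pi t : `|mod2pi t| <= pi.
Proof.
by have [/andP[l u] _] := mod2piP t; rewrite ler_norml l ltW.
Qed.

(** The bound is not strict: the two representatives pi and -pi of the antipode
    have the same absolute value. *)
Lemma norm_mod2pi_eq {s t} : congr2pi s t -> `|t| <= pi -> `|mod2pi s| = `|t|.
Proof.
have pi0 : 0 < pi :> R := pi_gt0 R.
move=> /mod2pi_congr ->; rewrite ler_norml => /andP[l].
rewrite le_eqVlt => /predU1P[->|u]; last by rewrite mod2pi_id ?l.
rewrite (mod2pi_uniq (u := - pi)) ?normrN //; first by apply/andP; split; lra.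
by exists 1; rewrite mulr1; lra.
Qed.

(** Converse of [mod2pi_setP]: being allowed to choose between pi and -pi means
    that every representative in the closed interval is admitted. *)
Lemma mod2pi_set_congr t u :
  congr2pi u t -> - pi <= u <= pi -> mod2pi_set t u.
Proof.
have pi0 : 0 < pi :> R := pi_gt0 R.
move=> ut /andP[l h].
have [ot|ot] := pselect (odd_pi t).
  right; split=> //; have [k tk] := ot; have [m e] := ut.
  have [um|] := boolP (- pi < u < pi); last first.
    by rewrite negb_and -!leNgt => /orP[] ?; [right|left]; lra.
  (* An odd multiple of pi cannot lie in the open interval. *)
  exfalso; have e1 : u = pi * (2 * (m + k) + 1)%:~R.
    by rewrite intrD intrM intrD tk in e *; lra.
  have := @int_lt1_eq0 R (2 * (m + k) + 1) pi pi0; rewrite -e1 => /(_ um).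
  lia.
left; split=> //; apply/esym/mod2pi_uniq; last exact: congr2pi_sym.
rewrite l lt_neqAle h andbT; apply/eqP => upi; apply: ot.
by have [k e] := ut; exists (- k); rewrite intrN; lra.
Qed.

Lemma inner_congr2pi {d} (w x y : 'cV[R]_d) : (forall i, w i 0 \is a Num.int) ->
  (forall i, congr2pi (x i 0) (y i 0)) -> congr2pi (inner x w) (inner y w).
Proof. by move=> wint xy; apply: congr2pi_sum => i; exact: congr2piMint. Qed.

End Congruence.

(** * The absolute cyclic difference *)

(** Splits a statement about all indices of a concrete dimension into the
    nested [lift]s produced by [big_ord_recl]. *)
Lemma forall_ordS {n} (P : 'I_n.+1 -> Prop) :
  P ord0 -> (forall i, P (lift ord0 i)) -> forall i, P i.
Proof. by move=> P0 PS i; have [j ->|->] := unliftP ord0 i. Qed.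

Section CyclicDifference.
Context {R : realType}.

Lemma diff_weight_int {d} {w : 'cV[R]_d} : diff_weight w ->
  forall i, w i 0 \is a Num.int.
Proof.
by case; do !apply: forall_ordS => [|];
  try (by case); rewrite mxE /= ?rpredN ?rpred1 ?natr_int.
Qed.

Lemma diff_weight_sqnorm2_gt1 {d} {w : 'cV[R]_d} :
  diff_weight w -> 1 < sqnorm2 w.
Proof. by case; rewrite /sqnorm2 !big_ord_recl big_ord0 !mxE /=; lra. Qed.

(** Such a coordinate is what separates the two minimizers in the antipodal
    case. *)
Lemma diff_weight_unit_coord {d} {w : 'cV[R]_d} : diff_weight w ->
  exists i, `|w i 0| = 1.
Proof. by case; exists ord0; rewrite mxE /= ?normrN normr1. Qed.

(** Unwrapping for the weight (1,-2,1), with the middle point moved to 0. Cut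
    the circle opposite to the middle point; if the sum of the other two then
    exceeds pi in absolute value, moving the cut past the extreme one of them
    corrects the sum by 2pi. *)
Lemma unwrap_triple (p q : R) : exists c p' q' : R,
  [/\ congr2pi p' p /\ congr2pi q' q, c <= 0 <= c + 2 * pi,
      c <= p' <= c + 2 * pi, c <= q' <= c + 2 * pi & `|p' + q'| <= pi].
Proof.
have pi0 : 0 < pi :> R := pi_gt0 R.
wlog pq : p q / mod2pi p <= mod2pi q => [wl|].
  have [pq|/ltW qp] := leP (mod2pi p) (mod2pi q); first exact: wl.
  have [c [q' [p' [[cq cp] h0 h1 h2 h3]]]] := wl _ _ qp.
  by exists c, p', q'; rewrite [p' + q']addrC.
have cp := congr2pi_mod2pi p; have cq := congr2pi_mod2pi q.
have [/andP[p1 p2] _] := mod2piP p; have [/andP[q1 q2] _] := mod2piP q.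
have [lo|hlo] := ltP (mod2pi p + mod2pi q) (- pi).
  exists (mod2pi p), (mod2pi p + 2 * pi), (mod2pi q); rewrite ler_norml.
  by split; [split=> //; exact: congr2pi_addl | | | | ];
    apply/andP; split; lra.
have [hi|hhi] := ltP pi (mod2pi p + mod2pi q).
  exists (mod2pi q - 2 * pi), (mod2pi p), (mod2pi q - 2 * pi).
  rewrite ler_norml.
  by split; [split=> //; exact: congr2pi_subl | | | | ];
    apply/andP; split; lra.
exists (- pi), (mod2pi p), (mod2pi q); rewrite ler_norml.
by split=> //; apply/andP; split; lra.
Qed.

(** Unwrapping for the weight (-1,1,1,-1), with the first point moved to 0. Start
    with the cut at 0, so that all representatives lie in [0, 2pi), and move it
    downwards past the largest points one after the other: a point of weight 1
    lowers the signed sum by 2pi, a point of weight -1 raises it by 2pi. The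
    cases below tell, from the order of the points and the size of the sum, how
    many points have to be passed. *)
Lemma unwrap_quadruple (p q r : R) : exists c p' q' r' : R,
  [/\ [/\ congr2pi p' p, congr2pi q' q & congr2pi r' r],
      c <= 0 <= c + 2 * pi,
      [/\ c <= p' <= c + 2 * pi, c <= q' <= c + 2 * pi &
          c <= r' <= c + 2 * pi]
    & `|p' + q' - r'| <= pi].
Proof.
have pi0 : 0 < pi :> R := pi_gt0 R.
have repr (t : R) : exists2 u, congr2pi u t & 0 <= u < 2 * pi.
  exists (mod2pi (t - pi) + pi).
    by rewrite -[X in congr2pi _ X](subrK pi); apply: congr2piD;
      [exact: congr2pi_mod2pi | exact: congr2pi_refl].
  by have [/andP[l u] _] := mod2piP (t - pi); apply/andP; split; lra.
have [p0 cp hp] := repr p; have [q0 cq hq] := repr q.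
have [r0 cr /andP[r1 r2]] := repr r.
wlog pq : p p0 q q0 cp cq hp hq / p0 <= q0 => [wl|].
  have [pq|/ltW qp] := leP p0 q0; first exact: (wl p p0 q q0).
  have [c [q' [p' [r' [[cq' cp' cr'] h0 [h1 h2 h3] h4]]]]] :=
    wl _ _ _ _ cq cp hq hp qp.
  by exists c, p', q', r'; rewrite [p' + q']addrC.
move: hp hq => /andP[p1 p2] /andP[q1 q2].
have [lo|hlo] := ltP (p0 + q0 - r0) (- pi).
  exists (r0 - 2 * pi), p0, q0, (r0 - 2 * pi); rewrite ler_norml.
  by split; [split=> //; exact: congr2pi_subl | | split | ];
    apply/andP; split; lra.
have [hi|hhi] := ltP pi (p0 + q0 - r0); last first.
  exists 0, p0, q0, r0; rewrite ler_norml.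
  by split=> //; [ | split | ]; apply/andP; split; lra.
(* Here the weights -1 and 1 of the two largest points cancel, so that the cut
   has to pass all three. *)
have [qr|rq] := ltP q0 r0.
  exists (p0 - 2 * pi), (p0 - 2 * pi), (q0 - 2 * pi), (r0 - 2 * pi).
  rewrite ler_norml.
  by split; [split=> //; exact: congr2pi_subl | | split | ];
    apply/andP; split; lra.
(* A sum above 3pi needs two corrections; it also forces r0 < p0, so that the
   two largest points are those of weight 1. *)
have [hi3|hhi3] := ltP (3 * pi) (p0 + q0 - r0).
  exists (p0 - 2 * pi), (p0 - 2 * pi), (q0 - 2 * pi), r0; rewrite ler_norml.
  by split; [split=> //; exact: congr2pi_subl | | split | ];
    apply/andP; split; lra.
exists (q0 - 2 * pi), p0, (q0 - 2 * pi), r0; rewrite ler_norml.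
by split; [split=> //; exact: congr2pi_subl | | split | ];
  apply/andP; split; lra.
Qed.

(** Every configuration can be lifted to the line within one period, [c] being
    the cut, such that its signed sum is a principal value. *)
Lemma diff_weight_unwrap {d} {w : 'cV[R]_d} (x : 'cV[R]_d) : diff_weight w ->
  exists (c : R) (y : 'cV[R]_d),
  [/\ forall i, congr2pi (y i 0) (x i 0), forall i, c <= y i 0 <= c + 2 * pi
    & `|inner y w| <= pi].
Proof.
have pi0 : 0 < pi :> R := pi_gt0 R.
have base (b s u : R) : congr2pi u (s - b) -> congr2pi (b + u) s.
  by case=> k e; exists k; lra.
move=> hw; case: hw x => x.
- set b := x ord0 0; set p := mod2pi (x (lift ord0 ord0) 0 - b).
  have /andP[p1 p2] : - pi <= p <= pi by rewrite -ler_norml mod2pi_norm_le_pi.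
  exists (b - pi), (\col_i [:: b; b + p]`_i); split.
  + do !apply: forall_ordS; try (by case); rewrite ?mxE /=;
      (exact/base/congr2pi_mod2pi || exact: congr2pi_refl).
  + do !apply: forall_ordS; try (by case); rewrite ?mxE /=;
      by apply/andP; split; lra.
  + rewrite /inner !big_ord_recl big_ord0 !mxE /= ler_norml.
    by apply/andP; split; lra.
- set b := x (lift ord0 ord0) 0.
  have [c [p [q [[cp cq] /andP[? ?] /andP[? ?] /andP[? ?]]]]] :=
    unwrap_triple (x ord0 0 - b) (x (lift ord0 (lift ord0 ord0)) 0 - b).
  rewrite ler_norml => /andP[? ?].
  exists (b + c), (\col_i [:: b + p; b; b + q]`_i); split.
  + do !apply: forall_ordS; try (by case); rewrite ?mxE /=;
      (exact: base || exact: congr2pi_refl).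
  + do !apply: forall_ordS; try (by case); rewrite ?mxE /=;
      by apply/andP; split; lra.
  + rewrite /inner !big_ord_recl big_ord0 !mxE /= ler_norml.
    by apply/andP; split; lra.
- set b := x ord0 0.
  have [c [p [q [r [[cp cq cr] /andP[? ?] [/andP[? ?] /andP[? ?] /andP[? ?]]]]]]] :=
    unwrap_quadruple (x (lift ord0 ord0) 0 - b)
      (x (lift ord0 (lift ord0 ord0)) 0 - b)
      (x (lift ord0 (lift ord0 (lift ord0 ord0))) 0 - b).
  rewrite ler_norml => /andP[? ?].
  exists (b + c), (\col_i [:: b; b + p; b + q; b + r]`_i); split.
  + do !apply: forall_ordS; try (by case); rewrite ?mxE /=;
      (exact: base || exact: congr2pi_refl).
  + do !apply: forall_ordS; try (by case); rewrite ?mxE /=;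
      by apply/andP; split; lra.
  + rewrite /inner !big_ord_recl big_ord0 !mxE /= ler_norml.
    by apply/andP; split; lra.
Qed.

Lemma cyc_diffE {d} {w : 'cV[R]_d} (x : 'cV[R]_d) : diff_weight w ->
  cyc_diff x w = `|mod2pi (inner x w)|.
Proof.
move=> hw; have wint := diff_weight_int hw.
have inner_shift (z : 'cV[R]_d) (a : R) :
    inner (\col_i (z i 0 + a)) w = inner z w.
  rewrite /inner; under eq_bigr do rewrite mxE mulrDl.
  by rewrite big_split /= -mulr_sumr diff_weight_sum0 // mulr0 addr0.
apply: is_minimum_inf; split.
  have [c [y [yx yc y_le]]] := diff_weight_unwrap x hw.
  (* This rotation moves the cut to the antipode of the base point. *)
  set a := - c - pi.
  exists a, (\col_i (y i 0 + a)); split=> [i|].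
    rewrite mxE; apply: mod2pi_set_congr.
      exact: congr2piD (yx i) (congr2pi_refl a).
    by have /andP[l u] := yc i; rewrite /a; apply/andP; split; lra.
  rewrite inner_shift; apply: norm_mod2pi_eq y_le.
  exact/congr2pi_sym/inner_congr2pi.
move=> _ [a [y [ya ->]]]; apply: norm_mod2pi_le_congr.
rewrite -(inner_shift x a); apply: inner_congr2pi => // i; rewrite mxE.
exact: (mod2pi_setP (ya i)).2.
Qed.

End CyclicDifference.

(** * Minimization of the energy *)

Section Energy.
Context {R : realType} {d : nat}.
Implicit Types (f v w x : 'cV[R]_d) (a c m lambda : R).

Lemma inner_subZ f w a : inner (f - a *: w) w = inner f w - a * sqnorm2 w.
Proof.
rewrite /inner /sqnorm2 mulr_sumr -sumrB; apply: eq_bigr => i _.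
by rewrite !mxE; ring.
Qed.

Lemma sqnorm2_addZ v w a :
  sqnorm2 (v + a *: w) = sqnorm2 v + 2 * a * inner v w + a ^+ 2 * sqnorm2 w.
Proof.
rewrite /inner /sqnorm2 !mulr_sumr -!big_split; apply: eq_bigr => i _ /=.
by rewrite !mxE; ring.
Qed.

Lemma sqnorm2_ge0 v : 0 <= sqnorm2 v.
Proof. by apply: sumr_ge0 => i _; exact: sqr_ge0. Qed.

Lemma sqnorm2_eq0 v : sqnorm2 v = 0 -> v = 0.
Proof.
move=> /psumr_eq0P v0; apply/colP => i; rewrite mxE; apply/eqP.
by rewrite -sqrf_eq0 v0 // => j _; exact: sqr_ge0.
Qed.

Lemma torus_mod2piv x : torus (mod2piv x).
Proof. by move=> i; rewrite mxE; exact: (mod2piP _).1. Qed.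

Definition displacement f x : 'cV[R]_d := \col_j mod2pi (x j 0 - f j 0).

Lemma mod2piv_displacement f x : torus x -> mod2piv (f + displacement f x) = x.
Proof.
move=> tx; apply/colP => i; rewrite !mxE -[RHS](mod2pi_id (tx i)).
apply: mod2pi_congr; rewrite -[X in congr2pi _ X](subrKC (f i 0)).
exact: congr2piD (congr2pi_refl _) (congr2pi_mod2pi _).
Qed.

Lemma energyE {lambda f w x} : diff_weight w -> energy lambda f w x =
  2^-1 * sqnorm2 (displacement f x) + lambda * `|mod2pi (inner x w)|.
Proof.
move=> hw; rewrite /energy cyc_diffE //; congr (_ * _ + _).
by apply: eq_bigr => i _; rewrite circle_distE real_normK ?num_real // mxE.
Qed.

(** Completing the square: with v the displacement, r = (<x,w>)_{2pi},
    c = r - <v,w>, e = sgn(c) and n = |w|^2,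
    |v|^2 = |v + e m w|^2 - 2 e m <v,w> - e^2 m^2 n, and
    - e m <v,w> = m |c| - e m r >= m |c| - lambda |r|. *)
Lemma energy_ge {lambda f w} m x : diff_weight w -> 0 <= m <= lambda ->
  exists2 c, congr2pi c (inner f w) &
    m * `|c| - 2^-1 * m ^+ 2 * sqnorm2 w
      + 2^-1 * sqnorm2 (displacement f x + (Num.sg c * m) *: w)
    <= energy lambda f w x.
Proof.
move=> hw /andP[m0 ml]; rewrite (energyE hw).
set v := displacement f x; set r := mod2pi (inner x w).
exists (r - inner v w).
  have -> : inner f w = inner x w - inner (x - f) w.
    by rewrite /inner -sumrB; apply: eq_bigr => i _; rewrite !mxE; ring.
  apply: congr2piB; first exact: congr2pi_mod2pi.
  apply: inner_congr2pi => [|i]; first exact: diff_weight_int.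
  by rewrite !mxE; exact: congr2pi_mod2pi.
rewrite sqnorm2_addZ.
have n0 := sqnorm2_ge0 w; have r0 := normr_ge0 r.
have mn0 : 0 <= m ^+ 2 * sqnorm2 w by rewrite mulr_ge0 ?sqr_ge0.
have mlr : m * `|r| <= lambda * `|r| by exact: ler_wpM2r.
have mr1 : m * r <= m * `|r| by rewrite ler_wpM2l ?ler_norm.
have mr2 : m * - r <= m * `|r| by rewrite ler_wpM2l // -normrN ler_norm.
have lr0 : 0 <= m * `|r| by exact: mulr_ge0.
case: (sgrP (r - inner v w)) => _; rewrite ?mul0r ?mul1r ?mulr0 ?expr0n /=; nra.
Qed.

(** The candidate shrinks the lifted difference [c] towards 0 by m n, so that its
    penalty is at most lambda (|c| - m n); this equals m (|c| - m n), because
    either m = lambda or the shrunken difference vanishes. *)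
Lemma energy_le {lambda f w} c m : diff_weight w -> 0 < lambda ->
  congr2pi c (inner f w) -> m = Num.min lambda (`|c| / sqnorm2 w) ->
  energy lambda f w (mod2piv (f - (Num.sg c * m) *: w))
    <= m * `|c| - 2^-1 * m ^+ 2 * sqnorm2 w.
Proof.
move=> hw l0 cf mE; rewrite (energyE hw).
have n1 := diff_weight_sqnorm2_gt1 hw.
have n0 : 0 < sqnorm2 w := lt_trans ltr01 n1.
set x := mod2piv _; set a := Num.sg c * m.
have m0 : 0 <= m by rewrite mE le_min ltW //= divr_ge0 // ltW.
have mn : m * sqnorm2 w <= `|c| by rewrite -ler_pdivlMr // mE ge_min lexx orbT.
have dist : sqnorm2 (displacement f x) <= m ^+ 2 * sqnorm2 w.
  rewrite /sqnorm2 mulr_sumr; apply: ler_sum => i _; rewrite !mxE.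
  rewrite -exprMn -[X in X <= _]real_normK ?num_real //.
  rewrite -[X in _ <= X]real_normK ?num_real //.
  rewrite lerXn2r ?nnegrE ?normr_ge0 //.
  apply: (@le_trans _ _ `|- (a * w i 0)|).
    apply: norm_mod2pi_le_congr.
    have e : - (a * w i 0) = f i 0 - a * w i 0 - f i 0 by ring.
    rewrite [X in congr2pi _ X]e.
    apply: congr2piB; last exact: congr2pi_refl.
    exact: congr2pi_mod2pi.
  rewrite normrN /a -mulrA normrM normr_sg.
  by case: (c != 0); rewrite ?mul1r ?mul0r.
have res : `|mod2pi (inner x w)| <= `|c| - m * sqnorm2 w.
  have -> : `|c| - m * sqnorm2 w = `|c - a * sqnorm2 w|.
    have mn0 : 0 <= m * sqnorm2 w by rewrite mulr_ge0 // ltW.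
    rewrite /a; move: mn; case: (sgrP c) => [->|c0|c0] mn.
    - by rewrite mul0r mul0r subr0 normr0; apply/eqP; rewrite subr_eq0; lra.
    - by rewrite mul1r ger0_norm // subr_ge0.
    - by rewrite ler0_norm; lra.
  apply: norm_mod2pi_le_congr.
  apply: (@congr2pi_trans _ _ (inner (f - a *: w) w)).
    apply: inner_congr2pi => [|i]; first exact: diff_weight_int.
    by rewrite /x !mxE; exact: congr2pi_mod2pi.
  rewrite inner_subZ; apply: congr2piB (congr2pi_refl _).
  exact: congr2pi_sym.
(* Complementary slackness for the two terms of the minimum. *)
have opt : lambda * (`|c| - m * sqnorm2 w) = m * (`|c| - m * sqnorm2 w).
  rewrite mE; case: leP => // _.
  by rewrite divfK ?gt_eqF // subrr !mulr0.
have := ler_wpM2l (ltW l0) res; rewrite opt; lra.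
Qed.

(** Both cases of the theorem at once: the representatives [c] of <f,w> of least
    absolute value parametrize the minimizers. *)
Lemma minimizersE {lambda f w} : diff_weight w -> 0 < lambda ->
  let t := mod2pi (inner f w) in
  let m := Num.min lambda (`|t| / sqnorm2 w) in
  minimizers (energy lambda f w) torus =
  [set mod2piv (f - (Num.sg c * m) *: w) |
    c in [set c | congr2pi c (inner f w) /\ `|c| = `|t|]].
Proof.
move=> hw l0 t m.
have n0 : 0 < sqnorm2 w := lt_trans ltr01 (diff_weight_sqnorm2_gt1 hw).
have ml : 0 <= m <= lambda.
  by rewrite ge_min lexx le_min (ltW l0) divr_ge0 // ltW.
have m0 := andP ml; case: m0 => m0 _.
set e := m * `|t| - 2^-1 * m ^+ 2 * sqnorm2 w.
have upper c : congr2pi c (inner f w) -> `|c| = `|t| ->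
    energy lambda f w (mod2piv (f - (Num.sg c * m) *: w)) <= e.
  by move=> cf ct; rewrite /e -ct; apply: energy_le => //; rewrite ct.
have tf : congr2pi t (inner f w) := congr2pi_mod2pi _.
apply/seteqP; split=> [x [tx xmin]|_ [c [cf ct] <-]]; last first.
  split=> [|y ty]; first exact: torus_mod2piv.
  apply: le_trans (upper _ cf ct) _.
  have [c' c'f] := energy_ge (f := f) m y hw ml; apply: le_trans.
  have := norm_mod2pi_le_congr (congr2pi_sym c'f); rewrite -/t => /(ler_wpM2l m0).
  have := sqnorm2_ge0 (displacement f y + (Num.sg c' * m) *: w).
  rewrite /e; lra.
have [c cf c_ge] := energy_ge (f := f) m x hw ml.
have tc : `|t| <= `|c|.
  rewrite /t -(mod2pi_congr cf); exact/norm_mod2pi_le_congr/congr2pi_refl.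
have := le_trans c_ge (le_trans (xmin _ (torus_mod2piv _)) (upper t tf erefl)).
have v0 := sqnorm2_ge0 (displacement f x + (Num.sg c * m) *: w).
have mtc := ler_wpM2l m0 tc.
rewrite /e => le_e.
have vE : displacement f x = - ((Num.sg c * m) *: w).
  by apply/eqP; rewrite -addr_eq0; apply/eqP/sqnorm2_eq0; lra.
have mct : m * (`|c| - `|t|) = 0 by rewrite mulrBr; lra.
have xE : x = mod2piv (f - (Num.sg c * m) *: w).
  by rewrite -vE mod2piv_displacement.
(* If m = 0, the sign of [c] is irrelevant and [t] represents the same point. *)
have [mz|mnz] := eqVneq m 0.
  by exists t => //; rewrite xE mz !mulr0.
exists c => //; split=> //; apply/eqP; rewrite -subr_eq0.
by move/eqP: mct; rewrite mulf_eq0 (negPf mnz).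
Qed.

End Energy.

Theorem theorem3p5 (R : realType) (d : nat) (w : 'cV[R]_d) (lambda : R)
    (f : 'cV[R]_d) (hw : diff_weight w) (hlambda : 0 < lambda) (hf : torus f) :
  let t := mod2pi (inner f w) in
  let s := Num.sg t in
  (`|t| < pi ->
    let m := Num.min lambda (`|t| / sqnorm2 w) in
    minimizers (energy lambda f w) torus = [set mod2piv (f - (s * m) *: w)]) /\
  (`|t| = pi ->
    let m := Num.min lambda (pi / sqnorm2 w) in
    let x1 := mod2piv (f - (s * m) *: w) in
    let x2 := mod2piv (f + (s * m) *: w) in
    x1 <> x2 /\ minimizers (energy lambda f w) torus = [set x1; x2]).
Proof.
move=> t s; have pi0 : 0 < pi :> R := pi_gt0 R.
have tf : congr2pi t (inner f w) := congr2pi_mod2pi _.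
split=> [t_lt m | t_pi m x1 x2].
  rewrite minimizersE //; apply/seteqP; split=> [_ [c [cf ct] <-]|_ ->] /=.
    have -> : c = t; last by [].
    rewrite /t -(mod2pi_congr cf) mod2pi_id //.
    by move: t_lt; rewrite -/t -ct ltr_norml => /andP[/ltW -> ->].
  by exists t.
have n1 := diff_weight_sqnorm2_gt1 hw.
have n0 : 0 < sqnorm2 w := lt_trans ltr01 n1.
have s1 : `|s| = 1.
  by rewrite normr_sg -normr_eq0 -/t t_pi gt_eqF.
split; last first.
  rewrite minimizersE // -/t t_pi -/m; apply/seteqP; split.
    move=> _ [c [cf ct] <-] /=.
    have /eqP := ct; rewrite -t_pi eqr_norm2 => /orP[]/eqP ->; first by left.
    by right; rewrite sgrN mulNr scaleNr opprK.
  move=> _ [|] -> /=; first by exists t.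
  exists (- t); last by rewrite sgrN mulNr scaleNr opprK.
  split; last by rewrite normrN.
  apply: congr2pi_trans tf.
  have [t0|t0] := lerP 0 t.
    by exists (-1); move: t_pi; rewrite ger0_norm // => ->; lra.
  by exists 1; move: t_pi; rewrite ltr0_norm // => <-; lra.
have m0 : 0 < m by rewrite lt_min hlambda divr_gt0.
have m_lt : m < pi.
  by rewrite gt_min ltr_pdivrMr // ltr_pMr // n1 orbT.
have [i wi] := diff_weight_unit_coord hw.
move=> /colP/(_ i); rewrite !mxE => x12.
have [k ek] : congr2pi (f i 0 + s * m * w i 0) (f i 0 - s * m * w i 0).
  apply: congr2pi_trans (congr2pi_mod2pi _); rewrite x12.
  exact/congr2pi_sym/congr2pi_mod2pi.
(* Before reduction, x1 and x2 differ by 2 m < 2pi in the chosen coordinate. *)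
have swm : `|s * m * w i 0| = m by rewrite !normrM s1 wi mul1r mulr1 gtr0_norm.
have k0 : k = 0.
  apply: (@int_lt1_eq0 _ k (2 * pi)); first lra.
  have /andP[? ?] : - pi < s * m * w i 0 < pi by rewrite -ltr_norml swm.
  rewrite -ek.
  by apply/andP; split; lra.
have : s * m * w i 0 = 0 by rewrite k0 mulr0 in ek; lra.
by move=> e; move: m0; rewrite -swm e normr0 ltxx.
Qed.
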